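(* Let $0<\delta<1$, $\zeta>0$ with $\zeta\delta<1$, and $\rho>0$. Let $\varepsilon_a,\varepsilon_r$ be positive numbers with $0<\varepsilon_a<\frac38$ and $\frac{6\varepsilon_a}{3-2\varepsilon_a}<\varepsilon_r<1$. Let $n_1<n_2<\cdots<n_s$ be the ascending arrangement of all distinct elements of $$\left\{\left\lceil\left[\frac32\left(\frac1{\varepsilon_a}-\frac1{\varepsilon_r}-\frac13\right)\right]^{\frac{i}{\tau}}\frac{4(3+\varepsilon_r)}{9\varepsilon_r}\ln\frac{1}{\zeta\delta}\right\rceil:i=0,1,\ldots,\tau\right\},\qquad \tau=\left\lceil\frac{\ln\left[\frac32\left(\frac1{\varepsilon_a}-\frac1{\varepsilon_r}-\frac13\right)\right]}{\ln(1+\rho)}\right\rceil .$$ For $\ell=1,\ldots,s$, let $K_\ell=\sum_{i=1}^{n_\ell}X_i$ and $\widehat p_\ell=K_\ell/n_\ell$. For $\ell=1,\ldots,s-1$, let $D_\ell=0$ if $$\frac12-\frac23\varepsilon_a-\sqrt{\frac14+\frac{n_\ell\varepsilon_a^2}{2\ln(\zeta\delta)}}<\widehat p_\ell<\frac{6(1-\varepsilon_r)(3-\varepsilon_r)\ln(\zeta\delta)}{2(3-\varepsilon_r)^2\ln(\zeta\delta)-9n_\ell\varepsilon_r^2}$$ or $$\frac12+\frac23\varepsilon_a-\sqrt{\frac14+\frac{n_\ell\varepsilon_a^2}{2\ln(\zeta\delta)}}<\widehat p_\ell<\frac{6(1+\varepsilon_r)(3+\varepsilon_r)\ln(\zeta\delta)}{2(3+\varepsilon_r)^2\ln(\zeta\delta)-9n_\ell\varepsilon_r^2},$$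 and $D_\ell=1$ otherwise; let $D_s=1$. Sampling is continued until $D_\ell=1$ for some $\ell\in\{1,\ldots,s\}$. Let $\mathbf n$ be the sample size when sampling is terminated and $\widehat p=\frac1{\mathbf n}\sum_{i=1}^{\mathbf n}X_i$. Define $p^\star=\varepsilon_a/\varepsilon_r$ and $$\mathscr Q_a^+=\bigcup_{\ell=1}^s\left\{\frac{k}{n_\ell}+\varepsilon_a\in(0,p^\star):k\in\mathbb Z\right\}\cup\{p^\star\},\qquad \mathscr Q_a^-=\bigcup_{\ell=1}^s\left\{\frac{k}{n_\ell}-\varepsilon_a\in(0,p^\star):k\in\mathbb Z\right\}\cup\{p^\star\},$$ $$\mathscr Q_r^+=\bigcup_{\ell=1}^s\left\{\frac{k}{n_\ell(1+\varepsilon_r)}\in(p^\star,1):k\in\mathbb Z\right\},\qquad \mathscr Q_r^-=\bigcup_{\ell=1}^s\left\{\frac{k}{n_\ell(1-\varepsilon_r)}\in(p^\star,1):k\in\mathbb Z\right\}.$$ Then $\Pr\left\{|\widehat p-p|<\varepsilon_a\text{ or }\left|\frac{\widehat p-p}{p}\right|<\varepsilon_r\,\Big|\,p\right\}>1-\delta$ for every $p\in(0,1)$, provided that $$\sum_{\ell=1}^s\Pr\{\widehat p_\ell\ge p+\varepsilon_a,\ D_{\ell-1}=0,\ D_\ell=1\mid p\}<\frac\delta2\quad\forall p\in\mathscr Q_a^-,$$ $$\sum_{\ell=1}^s\Pr\{\widehat p_\ell\le p-\varepsilon_a,\ D_{\ell-1}=0,\ D_\ell=1\mid p\}<\frac\delta2\quad\forall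 p\in\mathscr Q_a^+,$$ $$\sum_{\ell=1}^s\Pr\{\widehat p_\ell\ge p(1+\varepsilon_r),\ D_{\ell-1}=0,\ D_\ell=1\mid p\}<\frac\delta2\quad\forall p\in\mathscr Q_r^+,$$ $$\sum_{\ell=1}^s\Pr\{\widehat p_\ell\le p(1-\varepsilon_r),\ D_{\ell-1}=0,\ D_\ell=1\mid p\}<\frac\delta2\quad\forall p\in\mathscr Q_r^- .$$ Moreover, these four conditions are satisfied for $0<\zeta<\frac1{2(\tau+1)}$.
   Context: $X_1,X_2,\ldots$ are i.i.d. Bernoulli random variables with $\Pr\{X_i=1\}=1-\Pr\{X_i=0\}=p\in(0,1)$; $\Pr\{\cdot\mid p\}$ denotes probability when the Bernoulli parameter is $p$. $\lceil x\rceil$ is the smallest integer not less than $x$. By convention $D_0=0$. Sampling stops at the smallest index $\ell\ge1$ with $D_\ell=1$, and then $\mathbf n=n_\ell$ and $\widehat p=\widehat p_\ell$. *)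

(* Defs.v *)
From HB Require Import structures.
From mathcomp Require Export all_boot all_order all_algebra.
From mathcomp Require Export all_classical all_reals all_analysis.
Export Order.TTheory GRing.Theory Num.Theory.
Export numFieldNormedType.Exports.

Set Implicit Arguments.
Unset Strict Implicit.
Unset Printing Implicit Defensive.

Local Open Scope classical_set_scope.
Local Open Scope ring_scope.

Definition mutually_independent (d : measure_display) (T : measurableType d)
    (R : realType) (P : probability T R) (X : nat -> {mfun T >-> R}) : Prop :=
  forall (J : seq nat) (B : nat -> set R),
    uniq J -> (forall j, measurable (B j)) ->
    P (\bigcap_(j in [set` J]) (X j @^-1` B j)) =
    (\prod_(j <- J) P (X j @^-1` B j))%E.

Definition iid_bernoulli (d : measure_display) (T : measurableType d)
    (R : realType) (P : probability T R) (X : nat -> {mfun T >-> R}) (p : R) :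
    Prop :=
  mutually_independent P X /\
  forall i, P (X i @^-1` [set 1]) = p%:E /\ P (X i @^-1` [set 0]) = (1 - p)%:E.

(* Meaningful for [-1 < x], where the ceiling is nonnegative; the theorem's
   hypotheses make every argument it receives positive. *)
Definition nat_ceil (R : realType) (x : R) : nat := `|Num.ceil x|%N.

Section sampling_scheme.
Context (R : realType) (ea er zeta delta rho : R).

Definition growth : R := 3 / 2 * (1 / ea - 1 / er - 1 / 3).

Definition tau : nat := nat_ceil (ln growth / ln (1 + rho)).

Definition raw_size (i : nat) : nat :=
  nat_ceil (growth `^ (i%:R / tau%:R) * (4 * (3 + er) / (9 * er)) *
            ln (1 / (zeta * delta))).

Definition sizes : seq nat :=
  sort leq (undup [seq raw_size i | i <- iota 0 tau.+1]).

Definition nb_stages : nat := size sizes.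

(* Stages are numbered [1 <= l <= nb_stages]. *)
Definition stage_size (l : nat) : nat := nth 0%N sizes l.-1.

(* Values [z] of the sample mean of [n] observations for which sampling goes
   on.  As [L < 0], both denominators are negative; the radicand is positive
   at every stage but the last, where the region is not used. *)
Definition continue_region (n : nat) (z : R) : bool :=
  let L := ln (zeta * delta) in
  let r := Num.sqrt (1 / 4 + n%:R * ea ^+ 2 / (2 * L)) in
  (1 / 2 - 2 / 3 * ea - r < z <
     6 * (1 - er) * (3 - er) * L /
     (2 * (3 - er) ^+ 2 * L - 9 * n%:R * er ^+ 2))
  || (1 / 2 + 2 / 3 * ea - r < z <
     6 * (1 + er) * (3 + er) * L /
     (2 * (3 + er) ^+ 2 * L - 9 * n%:R * er ^+ 2)).

Definition pstar : R := ea / er.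

Definition Qa_plus : set R :=
  \bigcup_(l in [set l | (1 <= l <= nb_stages)%N])
    [set x | 0 < x < pstar /\
             exists k : int, x = k%:~R / (stage_size l)%:R + ea]
  `|` [set pstar].

Definition Qa_minus : set R :=
  \bigcup_(l in [set l | (1 <= l <= nb_stages)%N])
    [set x | 0 < x < pstar /\
             exists k : int, x = k%:~R / (stage_size l)%:R - ea]
  `|` [set pstar].

Definition Qr_plus : set R :=
  \bigcup_(l in [set l | (1 <= l <= nb_stages)%N])
    [set x | pstar < x < 1 /\
             exists k : int, x = k%:~R / ((stage_size l)%:R * (1 + er))].

Definition Qr_minus : set R :=
  \bigcup_(l in [set l | (1 <= l <= nb_stages)%N])
    [set x | pstar < x < 1 /\
             exists k : int, x = k%:~R / ((stage_size l)%:R * (1 - er))].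

Context (d : measure_display) (T : measurableType d)
  (X : nat -> {mfun T >-> R}).

(* [X i] is the [i.+1]-st observation: the first [n] observations are
   [X 0, ..., X n.-1]. *)
Definition sample_mean (n : nat) (t : T) : R := (\sum_(i < n) X i t) / n%:R.

Definition phat_ (l : nat) (t : T) : R := sample_mean (stage_size l) t.

(* [D_ 0 = 0] is the convention for "sampling has not stopped before stage 1";
   values at [l > nb_stages] are never used. *)
Definition D_ (l : nat) (t : T) : nat :=
  if l == 0%N then 0%N
  else if l == nb_stages then 1%N
  else if continue_region (stage_size l) (phat_ l t) then 0%N else 1%N.

(* The least [l] in [1 .. nb_stages] with [D_ l t = 1]. *)
Definition stopping_stage (t : T) : nat :=
  (find (fun l => D_ l t == 1%N) (iota 1 nb_stages)).+1.

Definition stopped_size (t : T) : nat := stage_size (stopping_stage t).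

Definition phat (t : T) : R := sample_mean (stopped_size t) t.

(* [P p] is the probability measure when the Bernoulli parameter is [p]. *)
Definition tail_conditions (P : R -> probability T R) : Prop :=
  [/\ forall p, Qa_minus p ->
        (\sum_(1 <= l < nb_stages.+1)
           P p [set t | ([/\ p + ea <= phat_ l t, D_ l.-1 t = 0%N
                           & D_ l t = 1%N])%R]
         < (delta / 2)%:E)%E,
      forall p, Qa_plus p ->
        (\sum_(1 <= l < nb_stages.+1)
           P p [set t | ([/\ phat_ l t <= p - ea, D_ l.-1 t = 0%N
                           & D_ l t = 1%N])%R]
         < (delta / 2)%:E)%E,
      forall p, Qr_plus p ->
        (\sum_(1 <= l < nb_stages.+1)
           P p [set t | ([/\ p * (1 + er) <= phat_ l t, D_ l.-1 t = 0%N
                           & D_ l t = 1%N])%R]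
         < (delta / 2)%:E)%E
    & forall p, Qr_minus p ->
        (\sum_(1 <= l < nb_stages.+1)
           P p [set t | ([/\ phat_ l t <= p * (1 - er), D_ l.-1 t = 0%N
                           & D_ l t = 1%N])%R]
         < (delta / 2)%:E)%E].

End sampling_scheme.

(* Main.v *)
(** Two facts about the Bernoulli likelihood [u ^ k (1 - u) ^ (n - k)] carry the
    proof, both applied outcome by outcome and then summed over the outcomes of
    an event decided by the first [n] observations.
    - It decreases as [u] moves away from [k / n].  Moving [p] to the nearest
      parameter at which the shifted threshold is an attainable sample mean
      leaves the error events unchanged and increases their probabilities, so
      the finitely many tail conditions control every [p].
    - It satisfies Massart's inequality.  Stopping at stage [l] means that
      Massart's exponent at [phat_l] is at least [ln (1 / (zeta delta))], which
      also holds unconditionally at the last stage because of its sample size;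
      hence each term of the sums is at most [zeta delta], and there are at most
      [tau + 1] terms. *)

Require Import Defs.
From mathcomp Require Import all_boot all_order all_algebra.
From mathcomp Require Import all_classical all_reals all_analysis.
From mathcomp Require Import measurable_realfun ring lra.

Import Order.TTheory GRing.Theory Num.Theory.

Set Implicit Arguments.
Unset Strict Implicit.
Unset Printing Implicit Defensive.

Local Open Scope classical_set_scope.
Local Open Scope ring_scope.

(** * Massart's inequality for the likelihood *)

(** On [p < u < z] the logarithmic derivative of the tilted likelihood is at least
    [(k + j) (z - u) (1 / (u (1 - u)) - c u)], hence nonnegative. The tilt [Q = 0] gives plain
    monotonicity; a tangent [c] of [1 / (u (1 - u))] gives Massart's exponent. *)
Lemma likelihood_le_tilted (R : realType) (p z : R) (Q c : R -> R) (k j : nat) :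
  0 < p -> p <= z -> z <= 1 -> z * (k + j)%:R <= k%:R ->
  (forall u : R, is_derive u (1 : R) Q (- (z - u) * c u)) ->
  (forall u : R, 0 < u < 1 -> c u * (u * (1 - u)) <= 1) ->
  p ^+ k * (1 - p) ^+ j * expR ((k + j)%:R * Q p) <=
  z ^+ k * (1 - z) ^+ j * expR ((k + j)%:R * Q z).
Proof.
move=> p0 pz z1 hk dQ hc.
pose f : R -> R := (id ^+ k * (cst 1 - id) ^+ j) *
  (expR \o (cst (k + j)%:R * Q)).
pose f' (u : R) : R :=
  (k%:R * u ^+ k.-1 * (1 - u) ^+ j - u ^+ k * (j%:R * (1 - u) ^+ j.-1)
   - u ^+ k * (1 - u) ^+ j * (k + j)%:R * (z - u) * c u)
   * expR ((k + j)%:R * Q u).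
have fE (u : R) : f u = u ^+ k * (1 - u) ^+ j * expR ((k + j)%:R * Q u).
  by rewrite /f !fctE.
have df (u : R) : is_derive u (1 : R) f (f' u).
  by apply: is_derive_eq; rewrite /f' !fctE /GRing.scale /=; ring.
rewrite -!fE.
apply: (@ger0_derive1_ndecr _ f p z) => //.
- move=> u; rewrite in_itv /= => /andP[pu uz].
  have u0 : 0 < u by exact: lt_trans pu.
  have u1 : 0 < 1 - u by rewrite subr_gt0 (lt_le_trans uz).
  rewrite derive1E (@derive_val _ _ _ _ _ _ _ (df u)) /f'.
  rewrite mulr_ge0 ?expR_ge0 //.
  (* Multiplying by [u (1 - u)] restores the lowered exponents; for [k = 0] or [j = 0] the numeric
     factor kills the truncated power. *)
  have kE : u * (k%:R * u ^+ k.-1) = k%:R * u ^+ k.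
    by case: (k) => [|i]; rewrite ?mul0r ?mulr0 //= exprS; ring.
  have jE : (1 - u) * (j%:R * (1 - u) ^+ j.-1) = j%:R * (1 - u) ^+ j.
    by case: (j) => [|i]; rewrite ?mul0r ?mulr0 //= exprS; ring.
  rewrite -(pmulr_rge0 _ (mulr_gt0 u0 u1)).
  set A := k%:R * _ in kE *; set B := j%:R * _ in jE *.
  set U := u ^+ k in kE *; set V := (1 - u) ^+ j in jE *.
  have -> : u * (1 - u) * (A * V - U * B - U * V * (k + j)%:R * (z - u) * c u)
     = U * V * (k%:R - u * (k + j)%:R -
         (k + j)%:R * (z - u) * (c u * (u * (1 - u)))).
    transitivity ((1 - u) * (u * A) * V - U * u * ((1 - u) * B) -
       U * V * (k + j)%:R * (z - u) * (c u * (u * (1 - u)))); first by ring.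
    by rewrite kE jE natrD; ring.
  rewrite mulr_ge0 //; first by rewrite mulr_ge0 ?exprn_ge0 ?ltW.
  have h1 : c u * (u * (1 - u)) <= 1 by apply: hc; rewrite u0 -subr_gt0.
  have h2 : (k + j)%:R * (z - u) * (c u * (u * (1 - u))) <= (k + j)%:R * (z - u).
    by rewrite ler_piMr // mulr_ge0 // subr_ge0 ltW.
  by lra.
- by apply: derivable_within_continuous => u _; exact: ex_derive.
Qed.

Lemma likelihood_le_above (R : realType) (p q : R) (k j : nat) :
  0 < p -> p <= q -> q <= 1 -> q * (k + j)%:R <= k%:R ->
  p ^+ k * (1 - p) ^+ j <= q ^+ k * (1 - q) ^+ j.
Proof.
move=> p0 pq q1 hk.
have := @likelihood_le_tilted R p q (cst 0) (cst 0) k j p0 pq q1 hk.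
rewrite !mulr0 expR0 !mulr1; apply => u; last by rewrite mul0r.
by rewrite mulr0; exact: is_derive_cst.
Qed.

(** Massart's lower bound for the relative entropy of Bernoulli [z] with respect to Bernoulli [p]:
    the denominator is twice the variance at the point one third of the way from [p] to [z]. *)
Definition massart_rate (R : realType) (p z : R) : R :=
  (z - p) ^+ 2 / (2 * ((2 * p + z) / 3) * (1 - (2 * p + z) / 3)).

(* With [n = k + j], the log of the likelihood ratio of [z] to [p] is at least
   [n] times the integral of [(z - u) / (u (1 - u))] over [p <= u <= z]; bound the convex function [1 / (u (1 - u))] below by its
   tangent [c] at the barycenter [m] of the weight [z - u].  [Q u] is the
   integral of [(z - s) c s] over [u <= s <= z]. *)
Lemma likelihood_massart_above (R : realType) (p z : R) (k j : nat) :
  0 < p -> p < z -> z <= 1 -> z * (k + j)%:R <= k%:R ->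
  p ^+ k * (1 - p) ^+ j <=
  expR (- ((k + j)%:R * massart_rate p z)) * (z ^+ k * (1 - z) ^+ j).
Proof.
move=> p0 pz z1 hk.
pose m := (2 * p + z) / 3; pose v := m * (1 - m).
have m0 : 0 < m by rewrite /m; lra.
have m1 : 0 < 1 - m by rewrite /m; lra.
have v0 : 0 < v by rewrite /v mulr_gt0.
pose A := v^-1; pose B := (2 * m - 1) / v ^+ 2.
pose Q : R -> R := cst (A / 2 + B * (z - m) / 2) * (cst z - id) ^+ 2
  - cst (B / 3) * (cst z - id) ^+ 3.
pose c u := A + B * (u - m).
have QE u : Q u = (A / 2 + B * (z - m) / 2) * (z - u) ^+ 2 - B / 3 * (z - u) ^+ 3.
  by rewrite /Q !fctE.
have dQ (u : R) : is_derive u (1 : R) Q (- (z - u) * c u).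
  by apply: is_derive_eq; rewrite /c !fctE /GRing.scale /=; field.
have hc (u : R) : 0 < u < 1 -> c u * (u * (1 - u)) <= 1.
  move=> /andP[u0 u1].
  (* The error of the tangent, written as an expression that is visibly nonnegative on the unit
     interval. *)
  have -> : c u * (u * (1 - u)) =
     1 - (u - m) ^+ 2 * ((1 - m) ^+ 2 * (1 - u) + m ^+ 2 * u) / v ^+ 2.
    by rewrite /c /A /B /v; field; rewrite !gt_eqF.
  rewrite gerBl divr_ge0 ?sqr_ge0 // mulr_ge0 ?sqr_ge0 //.
  by rewrite addr_ge0 // mulr_ge0 ?sqr_ge0 ?subr_ge0 ?ltW.
have Qz : Q z = 0 by rewrite QE subrr !expr0n /= !mulr0 subrr.
have Qp : Q p = massart_rate p z.
  rewrite QE /massart_rate -/m -(mulrA 2 m) -/v /A.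
  (* This relation makes the two terms in [B] cancel and leaves [(z - p) ^ 2 / (2 v)]. *)
  have -> : z - m = 2 / 3 * (z - p) by rewrite /m; field.
  by field; rewrite gt_eqF.
have := likelihood_le_tilted p0 (ltW pz) z1 hk dQ hc.
rewrite Qz mulr0 expR0 mulr1 Qp => h.
by rewrite expRN [_^-1 * _]mulrC ler_pdivlMr ?expR_gt0.
Qed.

(** * Events decided by finitely many observations *)

Definition ones (n : nat) (x : {ffun 'I_n -> bool}) : nat := #|[pred i | x i]|.

Definition weight (R : realType) (p : R) (n : nat) (x : {ffun 'I_n -> bool}) : R :=
  p ^+ ones x * (1 - p) ^+ (n - ones x).

Lemma ones_le (n : nat) (x : {ffun 'I_n -> bool}) : (ones x <= n)%N.
Proof. by rewrite -[leqRHS]card_ord max_card. Qed.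

Lemma weightE (R : realType) (p : R) (n : nat) (x : {ffun 'I_n -> bool}) :
  weight p x = \prod_i (if x i then p else 1 - p).
Proof.
rewrite /weight (bigID (fun i => x i)) /=; congr (_ * _).
- rewrite (eq_bigr (fun=> p)) => [|i ->//].
  by rewrite prodr_const.
- rewrite (eq_bigr (fun=> 1 - p)) => [|i /negbTE->//].
  rewrite prodr_const; congr (_ ^+ _).
  by rewrite -[X in (X - _)%N](card_ord n) -(cardC [pred i | x i]) addKn.
Qed.

Lemma weight_ge0 (R : realType) (p : R) (n : nat) (x : {ffun 'I_n -> bool}) :
  0 <= p <= 1 -> 0 <= weight p x.
Proof. by move=> /andP[p0 p1]; rewrite mulr_ge0 ?exprn_ge0 ?subr_ge0. Qed.

Lemma sum_weight (R : realType) (p : R) (n : nat) :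
  \sum_(x : {ffun 'I_n -> bool}) weight p x = 1.
Proof.
under eq_bigr do rewrite weightE.
rewrite -(bigA_distr_bigA (fun (_ : 'I_n) (b : bool) => if b then p else 1 - p)).
by rewrite big1 // => i _; rewrite big_bool /= addrC subrK.
Qed.

Lemma sum_onesE (R : realType) (n : nat) (x : {ffun 'I_n -> bool}) :
  \sum_i (x i)%:R = (ones x)%:R :> R.
Proof.
rewrite -natr_sum; congr (_%:R); rewrite /ones -sum1_card [RHS]big_mkcond /=.
by apply: eq_bigr => i _; rewrite inE; case: (x i).
Qed.

Section finite_dimensional_law.
Context (R : realType) (d : measure_display) (T : measurableType d).
Variable X : nat -> {mfun T >-> R}.

Definition cylinder (n : nat) (x : {ffun 'I_n -> bool}) : set T :=
  [set t | forall i : 'I_n, X i t = (x i)%:R].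

Definition determined (n : nat) (E : set T) : Prop :=
  forall t t', (forall i, (i < n)%N -> X i t = X i t') -> E t -> E t'.

(** For an event determined by the first [n] observations, meeting a cylinder is the same as
    containing it, unless the cylinder is empty; an empty one never occurs. *)
Definition occurs (n : nat) (E : set T) (x : {ffun 'I_n -> bool}) : bool :=
  `[< cylinder x `&` E !=set0 >].

(** Independence is stated for sets indexed by all of [nat], so the outcome is padded with [false]
    beyond [n]. *)
Lemma cylinder_bigcap (n : nat) (x : {ffun 'I_n -> bool}) :
  cylinder x = \bigcap_(j in [set` iota 0 n])
    X j @^-1` [set (odflt false (omap x (insub j)))%:R].
Proof.
apply/seteqP; split => t /= h.
- move=> j /=; rewrite mem_iota add0n => /= jn.
  by rewrite insubT /= (h (Ordinal jn)).
- move=> i; have := h i; rewrite /= mem_iota add0n ltn_ord => /(_ isT).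
  by rewrite valK.
Qed.

Lemma measurable_cylinder (n : nat) (x : {ffun 'I_n -> bool}) :
  measurable (cylinder x).
Proof.
by rewrite cylinder_bigcap; exact: fin_bigcap_measurable.
Qed.

Lemma trivIset_cylinder (n : nat) (D : set {ffun 'I_n -> bool}) :
  trivIset D (@cylinder n).
Proof.
move=> x y _ _ [t [/= hx hy]]; apply/ffunP => i.
have /eqP := hx i; rewrite hy eqr_nat; by case: (x i) (y i) => [] [].
Qed.

Context (P : probability T R) (p : R).
Hypothesis hX : iid_bernoulli P X p.

Lemma cylinder_prob (n : nat) (x : {ffun 'I_n -> bool}) :
  P (cylinder x) = (weight p x)%:E.
Proof.
have [ind dist] := hX.
rewrite cylinder_bigcap ind ?iota_uniq //.
rewrite -[n in iota 0 n]subn0 big_mkord weightE -prodEFin.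
apply: eq_bigr => i _; rewrite valK /=.
by have [h1 h0] := dist i; case: (x i).
Qed.

Lemma bigcup_cylinder_prob (n : nat) (D : pred {ffun 'I_n -> bool}) :
  P (\bigcup_(x in [set` D]) cylinder x) = (\sum_(x | D x) weight p x)%:E.
Proof.
rewrite measure_fin_bigcup //; last 2 first.
- exact: trivIset_cylinder.
- by move=> x _; exact: measurable_cylinder.
rewrite -sumEFin [RHS]bigfs ?index_enum_uniq //; last first.
  by move=> x _; rewrite mem_index_enum.
by apply: eq_fsbigr => x _; exact: cylinder_prob.
Qed.

(** The observations are 0 or 1 only almost surely, so [E] equals the union of the cylinders it
    meets only up to a null set. *)
Lemma determined_prob (n : nat) (E : set T) :
  measurable E -> determined n E ->
  P E = (\sum_(x | occurs E x) weight p (n := n) x)%:E.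
Proof.
move=> mE dE; rewrite -bigcup_cylinder_prob; apply/eqP; rewrite eq_le.
set U := \bigcup_(x in _) _.
set G := \bigcup_(x in [set` predT]) @cylinder n x.
have mU : measurable U.
  by apply: fin_bigcup_measurable => // x _; exact: measurable_cylinder.
have mG : measurable G.
  by apply: fin_bigcup_measurable => // x _; exact: measurable_cylinder.
(* The weights of all outcomes sum to 1, so the cylinders together carry full probability. *)
have PG : P (~` G) = 0%E.
  rewrite probability_setC // bigcup_cylinder_prob sum_weight.
  by rewrite -EFinB subrr.
apply/andP; split.
- apply: (@le_trans _ _ (P (U `|` ~` G))).
    apply: le_measure; rewrite ?inE //; first exact: measurableU (measurableC _).
    move=> t Et; have [[x _ xt]|] := pselect (G t); last by right.
    by left; exists x => //; apply/asboolP; exists t.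
  rewrite -[leRHS]adde0 -PG; apply: measureU2 => //.
  exact: measurableC.
- apply: le_measure; rewrite ?inE // => t [x /= /asboolP[t' [xt' Et']] xt].
  by apply: dE Et' => i i_n; have := xt (Ordinal i_n); rewrite /= => ->;
    have := xt' (Ordinal i_n).
Qed.

End finite_dimensional_law.

(** * Massart's exponent and the boundaries of the stopping rule *)

Lemma massart_rateC (R : realType) (p z : R) :
  massart_rate (1 - p) (1 - z) = massart_rate p z.
Proof.
rewrite /massart_rate.
have -> : (2 * (1 - p) + (1 - z)) / 3 = 1 - (2 * p + z) / 3 by field.
by set m := (2 * p + z) / 3; congr (_ / _); ring.
Qed.

(** For the parameter [z - e] the barycenter is [z - 2 / 3 * e]; the hypothesis is the bound on the
    exponent with its denominator cleared. The sign of [e] is free, so both tails are covered. *)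
Lemma massart_rate_abs (R : realType) (z e L N : R) :
  0 < z - 2 / 3 * e < 1 ->
  (z - 2 / 3 * e) * (1 - (z - 2 / 3 * e)) * (2 * L) <= N * e ^+ 2 ->
  L <= N * massart_rate (z - e) z.
Proof.
move=> /andP[]; set m := z - 2 / 3 * e => m0 m1 h.
rewrite /massart_rate; have -> : (2 * (z - e) + z) / 3 = m by rewrite /m; field.
rewrite opprB addrCA subrr addr0 mulrA ler_pdivlMr; last first.
  by rewrite !mulr_gt0 // subr_gt0.
by apply: le_trans h; rewrite le_eqVlt; apply/orP; left; apply/eqP; ring.
Qed.

(** For the parameter [z / (1 + r)] the cleared inequality has a common factor [z]; cancelling it
    leaves a condition linear in [z], which explains the rational boundary of the continuation
    region. *)
Lemma massart_rate_rel (R : realType) (z r L N : R) :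
  -1 < r -> 0 < z -> (2 * (z / (1 + r)) + z) / 3 < 1 ->
  6 * (1 + r) * (3 + r) * L <= z * (9 * N * r ^+ 2 + 2 * (3 + r) ^+ 2 * L) ->
  L <= N * massart_rate (z / (1 + r)) z.
Proof.
move=> r1 z0 m1 h.
have r0 : 0 < 1 + r by lra.
have r3 : 0 < 3 + r by lra.
have mE : (2 * (z / (1 + r)) + z) / 3 = z * (3 + r) / (3 * (1 + r)).
  by field; rewrite !gt_eqF.
rewrite /massart_rate; move: m1; rewrite mE => m1.
have m0 : 0 < z * (3 + r) / (3 * (1 + r)) by rewrite divr_gt0 ?mulr_gt0.
rewrite mulrA ler_pdivlMr; last by rewrite (mulr_gt0 (mulr_gt0 _ m0)) ?subr_gt0.
have -> : z - z / (1 + r) = z * r / (1 + r) by field; rewrite gt_eqF.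
rewrite -subr_ge0.
have -> : N * (z * r / (1 + r)) ^+ 2 - L * (2 * (z * (3 + r) / (3 * (1 + r))) *
    (1 - z * (3 + r) / (3 * (1 + r)))) =
  z / (9 * (1 + r) ^+ 2) * (z * (9 * N * r ^+ 2 + 2 * (3 + r) ^+ 2 * L)
    - 6 * (1 + r) * (3 + r) * L).
  by field; rewrite gt_eqF.
by rewrite mulr_ge0 ?subr_ge0 // divr_ge0 ?mulr_ge0 ?sqr_ge0 // ltW.
Qed.

(** With [m] the barycenter, [m (1 - m) = 1 / 4 - (1 / 2 - m) ^ 2], so the claim says that
    [(1 / 2 - m) ^ 2] is at least the radicand. *)
Lemma region_abs (R : realType) (z e l N : R) :
  l < 0 -> z <= 1 / 2 + 2 / 3 * e - Num.sqrt (1 / 4 + N * e ^+ 2 / (2 * l)) ->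
  (z - 2 / 3 * e) * (1 - (z - 2 / 3 * e)) * (2 * - l) <= N * e ^+ 2.
Proof.
move=> l0; set w := 1 / 4 + _; set m := z - 2 / 3 * e => h.
have hm : Num.sqrt w <= 1 / 2 - m by rewrite /m; lra.
have hs : w <= (1 / 2 - m) ^+ 2.
  (* A negative radicand, whose [Num.sqrt] is 0, is below any square. *)
  have [w0|w0] := leP 0 w; last by rewrite (le_trans (ltW w0)) ?sqr_ge0.
  by rewrite -(sqr_sqrtr w0) ler_pXn2r ?nnegrE ?sqrtr_ge0 // (le_trans _ hm) ?sqrtr_ge0.
have hN : N * e ^+ 2 = (w - 1 / 4) * (2 * l) by rewrite /w; field; rewrite lt_eqF.
rewrite hN -subr_ge0.
have -> : (w - 1 / 4) * (2 * l) - m * (1 - m) * (2 * - l) =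
   ((1 / 2 - m) ^+ 2 - w) * (2 * - l) by field.
by rewrite mulr_ge0 ?subr_ge0 // mulr_ge0 // oppr_ge0 ltW.
Qed.

Lemma region_rel (R : realType) (z r l N : R) :
  l < 0 -> 0 <= N -> -1 < r ->
  6 * (1 + r) * (3 + r) * l / (2 * (3 + r) ^+ 2 * l - 9 * N * r ^+ 2) <= z ->
  6 * (1 + r) * (3 + r) * - l <= z * (9 * N * r ^+ 2 + 2 * (3 + r) ^+ 2 * - l).
Proof.
move=> l0 N0 r1.
have r3 : 0 < 3 + r by lra.
have den : 0 < 9 * N * r ^+ 2 + 2 * (3 + r) ^+ 2 * - l.
  apply: ltr_wpDl; first by rewrite mulr_ge0 ?sqr_ge0 // mulr_ge0.
  by rewrite !mulr_gt0 ?oppr_gt0 ?exprn_gt0.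
rewrite -ler_pdivrMr // => h; apply: le_trans h.
rewrite le_eqVlt; apply/orP; left; apply/eqP.
rewrite mulrN mulNr -[in LHS]mulrN -invrN; congr (_ / _); ring.
Qed.

(** The variance [m (1 - m)] increases up to [1 / 2], so a bound at [m'] passes to every smaller
    barycenter. *)
Lemma final_abs (R : realType) (z e m' L N : R) : 0 <= L ->
  m' * (1 - m') * (2 * L) <= N * e ^+ 2 -> z - 2 / 3 * e <= m' -> m' <= 1 / 2 ->
  (z - 2 / 3 * e) * (1 - (z - 2 / 3 * e)) * (2 * L) <= N * e ^+ 2.
Proof.
set m := z - 2 / 3 * e => L0 h mm m2; apply: le_trans h.
rewrite ler_wpM2r ?mulr_ge0 // -subr_ge0.
have -> : m' * (1 - m') - m * (1 - m) = (m' - m) * (1 - m' - m) by ring.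
by rewrite mulr_ge0 //; lra.
Qed.

(** At [z = q (1 + r)] the conclusion is the variance bound at the barycenter [q (3 + r) / 3],
    multiplied by [9 (1 + r) / q]; its right-hand side only grows with [z]. *)
Lemma final_rel (R : realType) (z r q m' L N : R) :
  0 <= L -> 0 <= N -> -1 < r -> 0 < q ->
  m' * (1 - m') * (2 * L) <= N * (q * r) ^+ 2 ->
  q * (3 + r) / 3 <= m' -> m' <= 1 / 2 -> q * (1 + r) <= z ->
  6 * (1 + r) * (3 + r) * L <= z * (9 * N * r ^+ 2 + 2 * (3 + r) ^+ 2 * L).
Proof.
move=> L0 N0 r1 q0 hN hm m2 hz.
have r3 : 0 < 3 + r by lra.
have r0 : 0 < 1 + r by lra.
set m := q * (3 + r) / 3 in hm *.
have h : m * (1 - m) * (2 * L) <= N * (q * r) ^+ 2.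
  apply: le_trans hN; rewrite ler_wpM2r ?mulr_ge0 // -subr_ge0.
  have -> : m' * (1 - m') - m * (1 - m) = (m' - m) * (1 - m' - m) by ring.
  by rewrite mulr_ge0 //; lra.
apply: (@le_trans _ _ (q * (1 + r) * (9 * N * r ^+ 2 + 2 * (3 + r) ^+ 2 * L))).
  rewrite -subr_ge0.
  have -> : q * (1 + r) * (9 * N * r ^+ 2 + 2 * (3 + r) ^+ 2 * L) -
      6 * (1 + r) * (3 + r) * L =
    9 * (1 + r) / q * (N * (q * r) ^+ 2 - m * (1 - m) * (2 * L)).
    by rewrite /m; field; rewrite gt_eqF.
  by rewrite mulr_ge0 ?subr_ge0 // divr_ge0 ?mulr_ge0 // ltW.
apply: ler_wpM2r => //; apply: addr_ge0.
- by rewrite mulr_ge0 ?sqr_ge0 // mulr_ge0.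
- by rewrite mulr_ge0 // mulr_ge0 ?sqr_ge0.
Qed.

(** * Attainable sample means and the weights of outcomes *)

(** Applied to both orders, this selects the attainable sample mean of an error event that is
    closest to the true parameter. *)
Lemma seq_extremum (T : eqType) (r : rel T) (s : seq T) (B : pred T) :
  total r -> transitive r ->
  {in s, forall v, ~~ B v} \/
  exists v0, [/\ v0 \in s, B v0 & {in s, forall v, B v -> r v0 v}].
Proof.
move=> tot tr; have rr v : r v v by have := tot v v; rewrite orbb.
elim: s => [|v s IH]; first by left.
have [Bv|nBv] := boolP (B v); last first.
  case: IH => [h|[v0 [v0s Bv0 h]]].
    by left => w; rewrite inE => /predU1P[->//|]; exact: h.
  right; exists v0; split=> //; first by rewrite inE v0s orbT.
  by move=> w; rewrite inE => /predU1P[->|]; [rewrite (negPf nBv) | exact: h].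
right; case: IH => [h|[v0 [v0s Bv0 h]]].
  exists v; split=> //; first by rewrite mem_head.
  by move=> w; rewrite inE => /predU1P[->//|ws]; rewrite (negPf (h _ ws)).
have [vv|/negbTE nvv] := boolP (r v v0).
  exists v; split=> //; first by rewrite mem_head.
  by move=> w; rewrite inE => /predU1P[->//|ws Bw]; apply: tr (h _ ws Bw).
exists v0; split=> //; first by rewrite inE v0s orbT.
move=> w; rewrite inE => /predU1P[-> _|]; last exact: h.
by have := tot v v0; rewrite nvv.
Qed.

Definition means (R : realType) (n : nat) : seq R :=
  [seq k%:R / n%:R | k <- iota 0 n.+1].

Lemma means_itv (R : realType) (n : nat) (z : R) : z \in means R n -> 0 <= z <= 1.
Proof.
move=> /mapP[k]; rewrite mem_iota add0n ltnS => /= kn ->.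
have [->|n0] := posnP n; first by rewrite invr0 mulr0 lexx ler01.
by rewrite divr_ge0 //= ler_pdivrMr ?ltr0n // mul1r ler_nat.
Qed.

Section weights.
Context (R : realType) (n : nat) (x : {ffun 'I_n -> bool}).
Hypothesis n0 : (0 < n)%N.

Let mean : R := (ones x)%:R / n%:R.

Let splitE : (ones x + (n - ones x) = n)%N.
Proof. by rewrite subnKC ?ones_le. Qed.

Let splitE' : (n - ones x + ones x = n)%N.
Proof. by rewrite subnK ?ones_le. Qed.

Let le_above (z : R) : z <= mean -> z * n%:R <= (ones x)%:R.
Proof. by rewrite ler_pdivlMr ?ltr0n. Qed.

Let le_below (z : R) : mean <= z -> (1 - z) * n%:R <= (n - ones x)%:R.
Proof.
rewrite ler_pdivrMr ?ltr0n // natrB ?ones_le // mulrBl mul1r => h.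
by rewrite lerD2l lerN2.
Qed.

Lemma mem_means : mean \in means R n.
Proof. by apply/mapP; exists (ones x); rewrite // mem_iota add0n ltnS ones_le. Qed.

Lemma weight_le_above (p q : R) :
  0 < p -> p <= q -> q <= 1 -> q <= mean -> weight p x <= weight q x.
Proof.
move=> p0 pq q1 /le_above h; apply: likelihood_le_above => //.
by rewrite splitE.
Qed.

(** Exchanging zeros and ones and replacing each parameter by its complement reduces this to the
    upper case. *)
Lemma weight_le_below (p q : R) :
  0 <= q -> q <= p -> p < 1 -> mean <= q -> weight p x <= weight q x.
Proof.
move=> q0 qp p1 /le_below h; rewrite /weight mulrC [leRHS]mulrC.
have := @likelihood_le_above R (1 - p) (1 - q) (n - ones x) (ones x).
by rewrite splitE' !subKr; apply => //; lra.
Qed.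

Lemma weight_massart_above (p z : R) :
  0 < p -> p < z -> z <= 1 -> z <= mean ->
  weight p x <= expR (- (n%:R * massart_rate p z)) * weight z x.
Proof.
move=> p0 pz z1 /le_above h.
have := @likelihood_massart_above R p z (ones x) (n - ones x).
by rewrite splitE; apply.
Qed.

Lemma weight_massart_below (p z : R) :
  0 <= z -> z < p -> p < 1 -> mean <= z ->
  weight p x <= expR (- (n%:R * massart_rate p z)) * weight z x.
Proof.
move=> z0 zp p1 /le_below h; rewrite /weight mulrC [X in _ <= _ * X]mulrC.
have := @likelihood_massart_above R (1 - p) (1 - z) (n - ones x) (ones x).
by rewrite splitE' !subKr massart_rateC; apply => //; lra.
Qed.

End weights.

(** * Tail bounds for events decided by [n] observations *)

Section tail_bounds.
Context (R : realType) (d : measure_display) (T : measurableType d).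
Variables (X : nat -> {mfun T >-> R}) (n : nat).
Hypothesis n0 : (0 < n)%N.

Lemma sample_mean_cylinder (x : {ffun 'I_n -> bool}) (t : T) :
  cylinder X x t -> sample_mean X n t = (ones x)%:R / n%:R.
Proof.
by move=> h; rewrite /sample_mean -sum_onesE; congr (_ / _); exact: eq_bigr.
Qed.

Lemma determined_prob_le (P Q : probability T R) (p q : R) (E F : set T) :
  iid_bernoulli P X p -> iid_bernoulli Q X q -> 0 <= q <= 1 ->
  measurable E -> measurable F -> determined X n E -> determined X n F ->
  (forall (x : {ffun 'I_n -> bool}) t,
     cylinder X x t -> E t -> F t /\ weight p x <= weight q x) ->
  (P E <= Q F)%E.
Proof.
move=> hP hQ q01 mE mF dE dF h.
rewrite (determined_prob hP mE dE) (determined_prob hQ mF dF) lee_fin.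
rewrite big_mkcond [leRHS]big_mkcond; apply: ler_sum => x _.
case: ifPn => [/asboolP[t [xt Et]]|_]; last by case: ifP => // _; exact: weight_ge0.
have [Ft wx] := h x t xt Et.
by rewrite ifT //; apply/asboolP; exists t.
Qed.

(** A change of measure: the weights at [z] sum to 1, so a pointwise likelihood ratio bound is a
    bound on the probability. *)
Lemma determined_prob_bound (P : probability T R) (p z C : R) (E : set T) :
  iid_bernoulli P X p -> 0 <= z <= 1 -> 0 <= C ->
  measurable E -> determined X n E ->
  (forall (x : {ffun 'I_n -> bool}) t,
     cylinder X x t -> E t -> weight p x <= C * weight z x) ->
  (P E <= C%:E)%E.
Proof.
move=> hP z01 C0 mE dE h.
rewrite (determined_prob hP mE dE) lee_fin.
rewrite -[C]mulr1 -(sum_weight z n) mulr_sumr big_mkcond; apply: ler_sum => x _.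
case: ifPn => [/asboolP[t [xt Et]]|_]; first exact: h xt Et.
by rewrite mulr_ge0 ?weight_ge0.
Qed.

Context (P : probability T R) (p C : R) (E : set T) (B : pred R).
Hypotheses (hP : iid_bernoulli P X p) (p01 : 0 < p < 1) (C0 : 0 <= C).
Hypotheses (mE : measurable E) (dE : determined X n E).
Hypothesis EB : forall t, E t -> B (sample_mean X n t).

Let no_mean : {in means R n, forall v, ~~ B v} -> (P E <= C%:E)%E.
Proof.
(* No outcome meets [E], so the comparison parameter 0 is arbitrary. *)
move=> h; apply: (@determined_prob_bound P p 0 C E hP); rewrite ?lexx ?ler01 //.
move=> x t xt /EB; rewrite (sample_mean_cylinder xt) => hB.
by have := h _ (mem_means R x); rewrite hB.
Qed.

(** Take [z] the least attainable mean in [B]. For every outcome of [E] the weight grows from [p] to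
    [q] by monotonicity, and from [q] to [z] it gains the exponential factor. The intermediate [q]
    is there because stopping controls the exponent at a parameter tied to [z], not at [p]. *)
Lemma massart_tail_above :
  (forall z, 0 <= z <= 1 -> B z -> exists2 q, p <= q < z &
     expR (- (n%:R * massart_rate q z)) <= C) ->
  (P E <= C%:E)%E.
Proof.
move=> h; have [|[z [zm Bz zmin]]] :=
  @seq_extremum _ <=%R (means R n) B (@le_total _ R) (@le_trans _ R).
  exact: no_mean.
have /andP[z0 z1] := means_itv zm.
have [||q /andP[pq qz] hq] := h z; rewrite ?z0 //.
move: p01 => /andP[p0 p1].
apply: (@determined_prob_bound P p z C E hP); rewrite ?z0 // => x t xt /EB.
rewrite (sample_mean_cylinder xt) => Bx.
have zx := zmin _ (mem_means R x) Bx.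
apply: (@le_trans _ _ (weight q x)).
  by apply: weight_le_above => //; [exact: ltW (lt_le_trans qz _) |
    exact: le_trans (ltW qz) _].
apply: le_trans (weight_massart_above n0 _ qz z1 zx) _; first exact: lt_le_trans pq.
by rewrite ler_wpM2r // weight_ge0 ?z0.
Qed.

Lemma massart_tail_below :
  (forall z, 0 <= z <= 1 -> B z -> exists2 q, z < q <= p &
     expR (- (n%:R * massart_rate q z)) <= C) ->
  (P E <= C%:E)%E.
Proof.
move=> h; have [|[z [zm Bz zmax]]] :=
  @seq_extremum _ >=%R (means R n) B (@ge_total _ R) (@ge_trans _ R).
  exact: no_mean.
have /andP[z0 z1] := means_itv zm.
have [||q /andP[zq qp] hq] := h z; rewrite ?z0 //.
move: p01 => /andP[p0 p1].
apply: (@determined_prob_bound P p z C E hP); rewrite ?z0 // => x t xt /EB.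
rewrite (sample_mean_cylinder xt) => Bx.
have zx := zmax _ (mem_means R x) Bx.
apply: (@le_trans _ _ (weight q x)).
  by apply: weight_le_below => //; [exact: le_trans z0 (ltW zq) |
    exact: le_trans (ltW zq)].
apply: le_trans (weight_massart_below n0 z0 zq _ zx) _; first exact: le_lt_trans p1.
by rewrite ler_wpM2r // weight_ge0 ?z0.
Qed.

End tail_bounds.

(** * The sampling scheme *)

Section scheme_parameters.
Context (R : realType) (ea er zeta delta rho : R).
Hypotheses (hdelta : 0 < delta < 1) (hzeta : 0 < zeta) (hzd : zeta * delta < 1).
Hypothesis hrho : 0 < rho.
Hypotheses (hea : 0 < ea < 3 / 8) (her : 6 * ea / (3 - 2 * ea) < er < 1).

Local Notation L := (- ln (zeta * delta)).
Local Notation sizes := (sizes ea er zeta delta rho).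
Local Notation nb_stages := (nb_stages ea er zeta delta rho).
Local Notation stage_size := (stage_size ea er zeta delta rho).
Local Notation pstar := (pstar ea er).

Lemma ea_gt0 : 0 < ea. Proof. by have /andP[] := hea. Qed.

Lemma er_gt0 : 0 < er.
Proof.
have /andP[h _] := her; have /andP[e0 e1] := hea; apply: le_lt_trans h.
by rewrite divr_ge0 ?mulr_ge0 ?ltW //; lra.
Qed.

Lemma er_lt1 : er < 1. Proof. by have /andP[] := her. Qed.

Lemma pstar_gt0 : 0 < pstar.
Proof. by rewrite divr_gt0 ?ea_gt0 ?er_gt0. Qed.

Lemma pstar_er : pstar * er = ea.
Proof. by rewrite /pstar divfK // gt_eqF // er_gt0. Qed.

(** The lower bound on [er] in another form. The left-hand side is the barycenter for parameter
    [pstar] and sample mean [pstar + ea]; the variance is increasing below [1 / 2]. *)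
Lemma pstar_lt : pstar + ea / 3 < 1 / 2.
Proof.
have /andP[h _] := her; have /andP[e0 e1] := hea; have r0 := er_gt0.
have d0 : 0 < 3 - 2 * ea by lra.
have : pstar < (3 - 2 * ea) / 6.
  by rewrite /pstar ltr_pdivrMr //; move: h; rewrite ltr_pdivrMr //; lra.
by lra.
Qed.

Lemma growthE : growth ea er = 3 / 2 * (1 - (pstar + ea / 3)) / ea.
Proof. by rewrite /growth /pstar; field; rewrite !gt_eqF ?ea_gt0 ?er_gt0. Qed.

Lemma growth_gt1 : 1 < growth ea er.
Proof.
have /andP[e0 e1] := hea.
by rewrite growthE ltr_pdivlMr // mul1r; have := pstar_lt; lra.
Qed.

Lemma zd_gt0 : 0 < zeta * delta.
Proof. by rewrite mulr_gt0 //; have /andP[] := hdelta. Qed.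

Lemma ln_zd_lt0 : ln (zeta * delta) < 0.
Proof. by rewrite ln_lt0 // zd_gt0. Qed.

Lemma nat_ceil_ge (x : R) : 0 < x -> x <= (nat_ceil x)%:R.
Proof.
move=> x0; have c0 : 0 <= Num.ceil x.
  by rewrite ceil_ge0 (lt_trans _ x0) // ltrN10.
by rewrite /nat_ceil natr_absz ger0_norm // ceil_ge.
Qed.

Lemma nat_ceil_gt0 (x : R) : 0 < x -> (0 < nat_ceil x)%N.
Proof.
by move=> x0; rewrite -(ltr0n R) (lt_le_trans x0) // nat_ceil_ge.
Qed.

Lemma tau_gt0 : (0 < tau ea er rho)%N.
Proof.
apply: nat_ceil_gt0; rewrite divr_gt0 // ln_gt0 ?growth_gt1 //.
by rewrite ltrDl.
Qed.

Lemma raw_size_arg_gt0 (i : nat) :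
  0 < growth ea er `^ (i%:R / (tau ea er rho)%:R) * (4 * (3 + er) / (9 * er)) *
            ln (1 / (zeta * delta)).
Proof.
have r0 := er_gt0.
apply: mulr_gt0; last by rewrite div1r lnV ?posrE ?zd_gt0 // oppr_gt0 ln_zd_lt0.
apply: mulr_gt0; first by apply: powR_gt0; exact: lt_trans growth_gt1.
by rewrite divr_gt0 ?mulr_gt0 //; lra.
Qed.

Lemma mem_sizes (n : nat) :
  n \in sizes -> exists i, n = raw_size ea er zeta delta rho i.
Proof. by rewrite mem_sort mem_undup => /mapP[i _ ->]; exists i. Qed.

Lemma raw_size_tau_in : raw_size ea er zeta delta rho (tau ea er rho) \in sizes.
Proof.
rewrite mem_sort mem_undup; apply: map_f.
by rewrite mem_iota add0n leq0n ltnS leqnn.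
Qed.

Lemma nb_stages_gt0 : (0 < nb_stages)%N.
Proof. by have := raw_size_tau_in; rewrite /nb_stages; case: sizes. Qed.

Lemma nb_stages_le : (nb_stages <= (tau ea er rho).+1)%N.
Proof.
by rewrite /Defs.nb_stages size_sort (leq_trans (size_undup _)) // size_map size_iota.
Qed.

Lemma stage_size_gt0 (l : nat) : (1 <= l <= nb_stages)%N -> (0 < stage_size l)%N.
Proof.
move=> /andP[l1 ls]; have /mem_sizes[i ->] : stage_size l \in sizes.
  by apply: mem_nth; rewrite prednK.
exact/nat_ceil_gt0/raw_size_arg_gt0.
Qed.

Lemma stage_size_le (l m : nat) :
  (1 <= l <= m)%N -> (m <= nb_stages)%N -> (stage_size l <= stage_size m)%N.
Proof.
move=> /andP[l1 lm] ms; apply: sorted_leq_nth; rewrite ?inE.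
- exact: leq_trans.
- exact: leqnn.
- exact/sort_sorted/leq_total.
- by rewrite prednK // (leq_trans lm).
- by rewrite prednK // (leq_trans l1).
- by rewrite -ltnS !prednK // (leq_trans l1).
Qed.

(** Here [m = pstar + ea / 3]. Since [growth] is [3 / 2 * (1 - m) / ea], the argument of the ceiling
    at [i = tau] times [ea ^ 2] is exactly the left-hand side: the largest size makes the exponent
    reach [L] at [pstar]. *)
Lemma last_stage_size_ge :
  let m := pstar * (3 + er) / 3 in
  m * (1 - m) * (2 * L) <= (stage_size nb_stages)%:R * ea ^+ 2.
Proof.
move=> /=; set m := pstar * _ / 3; have e0 := ea_gt0; have r0 := er_gt0.
(* The sizes ascend, so the last one dominates this member; position [i] in the list is stage
   [i.+1]. *)
have h : (raw_size ea er zeta delta rho (tau ea er rho) <= stage_size nb_stages)%N.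
  have /(nthP 0%N)[i i_s <-] := raw_size_tau_in.
  by have := @stage_size_le i.+1 nb_stages; rewrite /stage_size /=; apply; rewrite ?i_s.
apply: (@le_trans _ _ ((raw_size ea er zeta delta rho (tau ea er rho))%:R * ea ^+ 2)).
  have := nat_ceil_ge (raw_size_arg_gt0 (tau ea er rho)).
  rewrite -/(raw_size _ _ _ _ _ _) divff; last by rewrite pnatr_eq0 gtn_eqF // tau_gt0.
  rewrite powRr1; last by rewrite ltW // (lt_trans _ growth_gt1).
  rewrite div1r lnV ?posrE ?zd_gt0 // => hr.
  apply: le_trans (ler_wpM2r (sqr_ge0 ea) hr).
  rewrite le_eqVlt; apply/orP; left; apply/eqP.
  by rewrite growthE /m /pstar; field; rewrite !gt_eqF.
by rewrite ler_wpM2r ?sqr_ge0 // ler_nat.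
Qed.

(* The exponent [n * massart_rate q z] is at least [L] for [q = z - e] (first
   alternative) or [q = z / (1 + r)] (second one). *)
Definition decisive (e r : R) (n : nat) (z : R) : bool :=
  ((z - 2 / 3 * e) * (1 - (z - 2 / 3 * e)) * (2 * L) <= n%:R * e ^+ 2)
  || (6 * (1 + r) * (3 + r) * L <=
      z * (9 * n%:R * r ^+ 2 + 2 * (3 + r) ^+ 2 * L)).

(** Each interval of the region serves one tail, the first with [(- ea, - er)] and the second with
    [(ea, er)]. Lying to its left gives the absolute alternative, to its right the relative one. *)
Lemma decisive_stop (n : nat) (z : R) : ~~ continue_region ea er zeta delta n z ->
  decisive ea er n z && decisive (- ea) (- er) n z.
Proof.
have l0 := ln_zd_lt0; have r0 := er_gt0; have r1 := er_lt1.
rewrite /continue_region negb_or => /andP[hm hp]; apply/andP; split; apply/orP.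
- move: hp; rewrite negb_and -!leNgt => /orP[h|h]; [left|right].
    exact: region_abs l0 h.
  by apply: region_rel l0 _ _ h => //; lra.
- move: hm; rewrite negb_and -!leNgt => /orP[h|h]; [left|right].
    by apply: region_abs l0 _; rewrite sqrrN mulrN.
  by apply: region_rel l0 _ _ _ => //; [lra | rewrite sqrrN].
Qed.

(** The case split is at [pstar + ea = pstar * (1 + er)], or [pstar - ea = pstar * (1 - er)], where
    the two error margins agree. On either side the bound at [m] extends by monotonicity. *)
Lemma decisive_last (z : R) :
  decisive ea er (stage_size nb_stages) z &&
  decisive (- ea) (- er) (stage_size nb_stages) z.
Proof.
have := last_stage_size_ge; set m := pstar * _ / 3; move=> /= hN.
have l0 := ln_zd_lt0; have r0 := er_gt0; have r1 := er_lt1; have e0 := ea_gt0.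
have L0 : 0 <= L by rewrite oppr_ge0 ltW.
have p0 := pstar_gt0.
have pe := pstar_er.
have mE : m = pstar + ea / 3 by rewrite /m; lra.
have m2 : m <= 1 / 2 by rewrite mE ltW // pstar_lt.
apply/andP; split; apply/orP.
- have [h|h] := leP z (pstar + ea); [left|right].
    by apply: final_abs L0 hN _ m2; rewrite mE; lra.
  apply: (@final_rel _ z er pstar m) => //; rewrite ?pe //; first lra.
  by rewrite mulrDr mulr1 pe ltW.
- have [h|h] := leP z (pstar - ea); [left|right].
    by apply: (@final_abs _ _ _ m); rewrite ?sqrrN // mE; lra.
  apply: (@final_rel _ z (- er) pstar m) => //; first lra.
  + by rewrite (mulrN pstar) sqrrN pe.
  + by rewrite mE; lra.
  + by rewrite mulrDr mulr1 mulrN pe ltW.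
Qed.


(** * Measurability of the stage events and their dependence on finitely many observations *)

Context (d : measure_display) (T : measurableType d).
Context (X : nat -> {mfun T >-> R}) (P : R -> probability T R).
Hypothesis hX : forall p : R, 0 < p < 1 -> iid_bernoulli (P p) X p.

Local Notation D_ := (D_ ea er zeta delta rho X).
Local Notation phat_ := (phat_ ea er zeta delta rho X).
Local Notation phat := (phat ea er zeta delta rho X).
Local Notation stopping_stage := (stopping_stage ea er zeta delta rho X).

Let measurable_le_ray (a : R) : measurable [set z : R | z <= a].
Proof. by rewrite -set_itvNyc. Qed.

Let measurable_ge_ray (a : R) : measurable [set z : R | a <= z].
Proof. by rewrite -set_itvcy. Qed.

#[local] Hint Resolve measurable_le_ray measurable_ge_ray : core.

Lemma measurable_sample_mean (n : nat) : measurable_fun setT (sample_mean X n).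
Proof.
apply: measurable_funM => //; exact: measurable_sum.
Qed.

Lemma measurable_phat_preimage (l : nat) (A : set R) :
  measurable A -> measurable [set t | A (phat_ l t)].
Proof.
move=> mA; rewrite -[X in measurable X]setTI.
exact: measurable_sample_mean.
Qed.

Lemma measurable_continue_region (n : nat) :
  measurable [set z | continue_region ea er zeta delta n z].
Proof.
rewrite (_ : [set z | _] = `]1 / 2 - 2 / 3 * ea -
    Num.sqrt (1 / 4 + n%:R * ea ^+ 2 / (2 * ln (zeta * delta))),
    6 * (1 - er) * (3 - er) * ln (zeta * delta) /
    (2 * (3 - er) ^+ 2 * ln (zeta * delta) - 9 * n%:R * er ^+ 2)[ `|`
  `]1 / 2 + 2 / 3 * ea -
    Num.sqrt (1 / 4 + n%:R * ea ^+ 2 / (2 * ln (zeta * delta))),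
    6 * (1 + er) * (3 + er) * ln (zeta * delta) /
    (2 * (3 + er) ^+ 2 * ln (zeta * delta) - 9 * n%:R * er ^+ 2)[).
  exact: measurableU.
by apply/seteqP; split=> z /=; rewrite /continue_region !in_itv /= => /orP.
Qed.

Lemma measurable_D (l k : nat) : measurable [set t | D_ l t = k].
Proof.
have cst_mea (b : nat) : measurable [set t : T | b = k].
  have [->|bk] := eqVneq b k; first by rewrite (_ : [set _ | _] = setT) //; apply/seteqP.
  rewrite (_ : [set _ | _] = set0) //; apply/seteqP; split=> // t /= h.
  by rewrite h eqxx in bk.
rewrite /Defs.D_; case: (l == 0%N) => //; case: (l == nb_stages) => //.
rewrite (_ : [set t | _] =
  [set t | continue_region ea er zeta delta (stage_size l) (phat_ l t)] `&`
    [set t | 0%N = k] `|`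
  ~` [set t | continue_region ea er zeta delta (stage_size l) (phat_ l t)] `&`
    [set t | 1%N = k]).
  have mC := measurable_phat_preimage l (measurable_continue_region (stage_size l)).
  by apply: measurableU; apply: measurableI => //; exact: measurableC.
apply/seteqP; split=> t /=; case: ifP => h.
- by left.
- by right; split=> //; rewrite h.
- by move=> [[_ ?]|[/(_ isT)]].
- by move=> [[]|[_ ?]].
Qed.

(** For a closed half-line [A] this is a summand of [tail_conditions] up to conversion; an
    intersection of two half-lines expresses failure of both error criteria. *)
Definition stage_event (l : nat) (A : set R) : set T :=
  [set t | [/\ A (phat_ l t), D_ l.-1 t = 0%N & D_ l t = 1%N]].

Lemma measurable_stage_event (l : nat) (A : set R) :
  measurable A -> measurable (stage_event l A).
Proof.
move=> mA; rewrite (_ : stage_event l A = [set t | A (phat_ l t)] `&`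
  ([set t | D_ l.-1 t = 0%N] `&` [set t | D_ l t = 1%N])).
  apply: measurableI; first exact: measurable_phat_preimage.
  by apply: measurableI; exact: measurable_D.
by apply/seteqP; split=> t /= []; [move=> ? ? ?; split|move=> ? [? ?]; split].
Qed.

Lemma sample_mean_determined (n m : nat) (t t' : T) : (n <= m)%N ->
  (forall i, (i < m)%N -> X i t = X i t') -> sample_mean X n t = sample_mean X n t'.
Proof.
move=> nm h; rewrite /sample_mean; congr (_ / _); apply: eq_bigr => i _.
by apply: h; exact: leq_trans nm.
Qed.

Lemma stage_event_determined (l : nat) (A : set R) :
  (1 <= l <= nb_stages)%N -> determined X (stage_size l) (stage_event l A).
Proof.
move=> /andP[l1 ls] t t' h.
have phE (m : nat) : (1 <= m <= l)%N -> phat_ m t = phat_ m t'.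
  by move=> ml; apply: sample_mean_determined h; exact: stage_size_le.
have DE (m : nat) : (m <= l)%N -> D_ m t = D_ m t'.
  (* At [m = 0] the decision is constant, so sample means are compared only from stage 1 on. *)
  move=> ml; rewrite /Defs.D_; case: eqP => // /eqP; rewrite -lt0n => m0.
  by rewrite (phE m) // m0.
have l1l : (l.-1 <= l)%N by rewrite leq_pred.
by rewrite /stage_event /= (phE l) ?l1 ?leqnn // !DE.
Qed.

Lemma stage_event_decisive (l : nat) (A : set R) (t : T) :
  (1 <= l <= nb_stages)%N -> stage_event l A t ->
  decisive ea er (stage_size l) (phat_ l t) &&
  decisive (- ea) (- er) (stage_size l) (phat_ l t).
Proof.
move=> /andP[l1 ls] [_ _]; rewrite /Defs.D_.
have -> /= : (l == 0)%N = false by case: (l) l1.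
case: eqP => [-> _|_]; first exact: decisive_last.
case: ifPn => // h _; exact: decisive_stop.
Qed.

(** * Probability of an error at one stage *)

Let rate_exp (N q z : R) : L <= N * massart_rate q z ->
  expR (- (N * massart_rate q z)) <= zeta * delta.
Proof.
move=> h; rewrite -[leRHS]lnK ?posrE ?zd_gt0 // ler_expR; lra.
Qed.

(** Both errors are assumed so that [z - ea] and [z / (1 + er)] are each at least [p]: whichever
    alternative of [decisive] holds, its parameter lies between [p] and [z]. *)
Lemma stage_prob_above (l : nat) (p : R) (A : set R) :
  (1 <= l <= nb_stages)%N -> 0 < p < 1 -> measurable A ->
  (forall z, A z -> p + ea <= z /\ p * (1 + er) <= z) ->
  (P p (stage_event l A) <= (zeta * delta)%:E)%E.
Proof.
move=> hl p01 mA hA; have n0 := stage_size_gt0 hl.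
have e0 := ea_gt0; have r0 := er_gt0.
have l0 := ln_zd_lt0; have /andP[p0 p1] := p01.
apply: (@massart_tail_above _ _ _ X (stage_size l) n0 (P p) p _ _
  (fun z => [&& p + ea <= z, p * (1 + er) <= z & decisive ea er (stage_size l) z])
  (hX p01) p01).
- by rewrite ltW // zd_gt0.
- exact: measurable_stage_event.
- exact: stage_event_determined.
- move=> t Et; have /andP[hd _] := stage_event_decisive hl Et.
  by have [/hA[-> ->] _ _] := Et.
move=> z /andP[z0 z1] /and3P[pz prz /orP[h|h]].
- exists (z - ea); first by apply/andP; split; lra.
  by apply/rate_exp/massart_rate_abs => //; apply/andP; split; lra.
- have zp : 0 < z by lra.
  have r1 : 0 < 1 + er by lra.
  have qz : z / (1 + er) < z by rewrite ltr_pdivrMr // ltr_pMr //; lra.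
  exists (z / (1 + er)); first by rewrite qz ler_pdivlMr // prz.
  by apply/rate_exp/massart_rate_rel => //; lra.
Qed.

Lemma stage_prob_below (l : nat) (p : R) (A : set R) :
  (1 <= l <= nb_stages)%N -> 0 < p < 1 -> measurable A ->
  (forall z, A z -> z <= p - ea /\ z <= p * (1 - er)) ->
  (P p (stage_event l A) <= (zeta * delta)%:E)%E.
Proof.
move=> hl p01 mA hA; have n0 := stage_size_gt0 hl.
have e0 := ea_gt0; have r0 := er_gt0; have r1 := er_lt1.
have l0 := ln_zd_lt0; have /andP[p0 p1] := p01.
apply: (@massart_tail_below _ _ _ X (stage_size l) n0 (P p) p _ _
  (fun z => [&& z <= p - ea, z <= p * (1 - er) &
     decisive (- ea) (- er) (stage_size l) z])
  (hX p01) p01).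
- by rewrite ltW // zd_gt0.
- exact: measurable_stage_event.
- exact: stage_event_determined.
- move=> t Et; have /andP[_ hd] := stage_event_decisive hl Et.
  by have [/hA[-> ->] _ _] := Et.
move=> z /andP[z0 z1] /and3P[pz prz /orP[h|h]].
- exists (z + ea); first by apply/andP; split; lra.
  by rewrite -[ea in z + ea]opprK; apply/rate_exp/massart_rate_abs => //;
    apply/andP; split; lra.
- have r2 : 0 < 1 - er by lra.
  (* At [z = 0] the relative alternative would bound a positive number by 0; positivity makes
     [z / (1 - er)] strictly larger than [z]. *)
  have zp : 0 < z.
    rewrite lt_neqAle z0 andbT; apply: contraTneq h => <-.
    by rewrite mul0r -ltNge !mulr_gt0 //; lra.
  have qz : z < z / (1 - er) by rewrite ltr_pdivlMr // gtr_pMr //; lra.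
  have qp : z / (1 - er) <= p by rewrite ler_pdivrMr.
  exists (z / (1 - er)); first by rewrite qz.
  by apply/rate_exp/massart_rate_rel => //; lra.
Qed.

Lemma stage_sum_lt (F : nat -> \bar R) :
  zeta < 1 / (2 * ((tau ea er rho)%:R + 1)) ->
  (forall l, (1 <= l <= nb_stages)%N -> (F l <= (zeta * delta)%:E)%E) ->
  (\sum_(1 <= l < nb_stages.+1) F l < (delta / 2)%:E)%E.
Proof.
move=> hz hF; have /andP[d0 d1] := hdelta.
apply: (@le_lt_trans _ _ (\sum_(1 <= l < nb_stages.+1) (zeta * delta)%:E)%E).
  by rewrite big_nat [leRHS]big_nat; apply: lee_sum => l; rewrite ltnS; exact: hF.
rewrite sumEFin sumr_const_nat subn1 /= lte_fin -[ltLHS]mulr_natl.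
have t0 : 0 < (tau ea er rho)%:R + 1 :> R by rewrite ltr_wpDl.
apply: (@le_lt_trans _ _ (((tau ea er rho)%:R + 1) * (zeta * delta))).
  by rewrite ler_pM2r ?zd_gt0 // natr1 ler_nat nb_stages_le.
rewrite mulrA mulrC ltr_pM2l //.
move: hz; rewrite ltr_pdivlMr ?mulr_gt0 //; lra.
Qed.

(** Up to [pstar] the absolute margin [ea] dominates [p * er], and beyond it the order reverses; in
    each range the one-criterion error of the condition therefore implies the other error as
    well. *)
Lemma tail_conditions_small_zeta :
  zeta < 1 / (2 * ((tau ea er rho)%:R + 1)) ->
  tail_conditions ea er zeta delta rho X P.
Proof.
move=> hz; have e0 := ea_gt0; have r0 := er_gt0; have pe := pstar_er.
have q0 := pstar_gt0; have q1 := pstar_lt.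
have abs_p (p : R) : 0 < p < pstar \/ p = pstar ->
    0 < p < 1 /\ p * er <= ea.
  move=> [/andP[p0 pq]|->]; last by split; [apply/andP; split; lra | lra].
  by split; [apply/andP; split; lra | rewrite -pe ler_pM2r // ltW].
have rel_p (p : R) : pstar < p < 1 -> 0 < p < 1 /\ ea <= p * er.
  move=> /andP[pq p1]; split; first by apply/andP; split; lra.
  by rewrite -pe ler_pM2r // ltW.
have Q_abs (p : R) (Q : nat -> set R) :
    (\bigcup_(l in [set l | (1 <= l <= nb_stages)%N])
      [set x | 0 < x < pstar /\ Q l x] `|` [set pstar]) p ->
    0 < p < pstar \/ p = pstar.
  by move=> [[l _ [h _]]|h]; [left|right].
split=> p hp; apply: stage_sum_lt => // l hl.
- have [p01 h] := abs_p p (Q_abs _ _ hp).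
  apply: (@stage_prob_above l p [set z | p + ea <= z]) => // z /= hz'.
  by split=> //; lra.
- have [p01 h] := abs_p p (Q_abs _ _ hp).
  apply: (@stage_prob_below l p [set z | z <= p - ea]) => // z /= hz'.
  by split=> //; lra.
- have [p01 h] : 0 < p < 1 /\ ea <= p * er by case: hp => m _ [/rel_p].
  apply: (@stage_prob_above l p [set z | p * (1 + er) <= z]) => // z /= hz'.
  by split=> //; lra.
- have [p01 h] : 0 < p < 1 /\ ea <= p * er by case: hp => m _ [/rel_p].
  apply: (@stage_prob_below l p [set z | z <= p * (1 - er)]) => // z /= hz'.
  by split=> //; lra.
Qed.

(** * Coverage from the tail conditions *)

(** The stopping decisions depend on the observations alone, so only the threshold and the parameter
    change, and [q] lies between [p] and each attainable mean in [A]. *)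
Lemma stage_sum_le (p q : R) (A A' : set R) :
  0 < p < 1 -> 0 < q < 1 -> measurable A -> measurable A' ->
  (forall l, (1 <= l <= nb_stages)%N -> forall z, z \in means R (stage_size l) ->
     A z -> A' z /\ (p <= q <= z \/ z <= q <= p)) ->
  (\sum_(1 <= l < nb_stages.+1) P p (stage_event l A) <=
   \sum_(1 <= l < nb_stages.+1) P q (stage_event l A'))%E.
Proof.
move=> p01 q01 mA mA' h; rewrite big_nat [leRHS]big_nat; apply: lee_sum => l.
rewrite ltnS => hl; have n0 := stage_size_gt0 hl.
have /andP[p0 p1] := p01; have /andP[q0 q1] := q01.
apply: (@determined_prob_le _ _ _ X (stage_size l) _ _ p q) => //.
- exact: hX.
- exact: hX.
- by rewrite !ltW.
- exact: measurable_stage_event.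
- exact: measurable_stage_event.
- exact: stage_event_determined.
- exact: stage_event_determined.
move=> x t xt [At D0 D1]; have zE := sample_mean_cylinder xt.
have [|A't hq] := h l hl (phat_ l t) _ At.
  by rewrite /Defs.phat_ zE mem_means.
split; first by split.
move: hq; rewrite /Defs.phat_ zE => -[/andP[pq qz]|/andP[zq qp]].
- by apply: weight_le_above => //; exact: ltW.
- by apply: weight_le_below => //; exact: ltW.
Qed.

Let grid : seq R := flatten [seq means R (stage_size l) | l <- iota 1 nb_stages].

Let mem_grid (l : nat) (z : R) :
  (1 <= l <= nb_stages)%N -> z \in means R (stage_size l) -> z \in grid.
Proof.
move=> hl zl; apply/flatten_mapP; exists l => //.
by rewrite mem_iota add1n ltnS.
Qed.

Let gridP (z : R) : z \in grid -> exists l, (1 <= l <= nb_stages)%N /\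
  exists k : int, z = k%:~R / (stage_size l)%:R.
Proof.
move=> /flatten_mapP[l]; rewrite mem_iota add1n ltnS => hl /mapP[k _ ->].
by exists l; split=> //; exists k%:Z; rewrite pmulrn.
Qed.

Let grid_itv (z : R) : z \in grid -> 0 <= z <= 1.
Proof. by move=> /flatten_mapP[l _]; exact: means_itv. Qed.

Hypothesis htail : tail_conditions ea er zeta delta rho X P.

Let pstar01 : 0 < pstar < 1.
Proof.
by have := pstar_lt; have := pstar_gt0; have := ea_gt0; move=> *; apply/andP; split; lra.
Qed.

(** Let [v] be the largest attainable mean in the error set. The parameter moves down to [v + ea] if
    [v <= pstar - ea], and to [v / (1 - er)] otherwise; these lie in [Qa_plus] and [Qr_minus], and
    [v] becomes the exact threshold. *)
Lemma tail_sum_below (p : R) : 0 < p < 1 ->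
  (\sum_(1 <= l < nb_stages.+1)
    P p (stage_event l [set z | (z <= p - ea /\ z <= p * (1 - er))%R])
   < (delta / 2)%:E)%E.
Proof.
move=> p01; have /andP[p0 p1] := p01; have [_ hQa _ hQr] := htail.
have e0 := ea_gt0; have r0 := er_gt0; have r1 := er_lt1; have pe := pstar_er.
set A := [set z | _]; have mA : measurable A by apply: measurableI; exact: measurable_le_ray.
have [none|[v [vg /andP[v1 v2] vmax]]] := @seq_extremum _ >=%R grid
  (fun z => (z <= p - ea) && (z <= p * (1 - er))) (@ge_total _ R) (@ge_trans _ R).
  (* No attainable mean is an error, so the comparison is vacuous and [pstar] serves as a
     parameter. *)
  apply: le_lt_trans (hQa pstar _); last by right.
  apply: (@stage_sum_le p pstar A [set z | z <= pstar - ea]) => // l hl z zl [z1 z2].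
  by have := none z (mem_grid hl zl); rewrite z1 z2.
have [l [hl [k vk]]] := gridP vg; have /andP[vge0 _] := grid_itv vg.
have [vle|vgt] := leP v (pstar - ea).
- apply: le_lt_trans (hQa (v + ea) _); last first.
    have [vlt|] := ltP (v + ea) pstar; last by right => /=; lra.
    left; exists l => //=; split; first by apply/andP; split; lra.
    by exists k; rewrite vk.
  apply: (@stage_sum_le p (v + ea) A [set z | z <= v + ea - ea]) => //.
    by apply/andP; split; lra.
  move=> m hm z zm [z1 z2] /=; have zv : z <= v.
    by apply: vmax; [exact: mem_grid zm | rewrite z1 z2].
  by split; [lra | right; apply/andP; split; lra].
- have r2 : 0 < 1 - er by lra.
  have qp : v / (1 - er) <= p by rewrite ler_pdivrMr.
  have ql : pstar < v / (1 - er) by rewrite ltr_pdivlMr // mulrBr mulr1 pe.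
  have ps0 := pstar_gt0.
  apply: le_lt_trans (hQr (v / (1 - er)) _); last first.
    exists l => //=; split; first by apply/andP; split; lra.
    by exists k; rewrite vk invfM mulrA.
  apply: (@stage_sum_le p (v / (1 - er)) A
    [set z | z <= v / (1 - er) * (1 - er)]) => //.
    by apply/andP; split; lra.
  have vq : v <= v / (1 - er) by rewrite ler_pdivlMr // ler_piMr //; lra.
  move=> m hm z zm [z1 z2] /=; have zv : z <= v.
    by apply: vmax; [exact: mem_grid zm | rewrite z1 z2].
  rewrite divfK ?gt_eqF //; split=> //; right; apply/andP; split; lra.
Qed.

Lemma tail_sum_above (p : R) : 0 < p < 1 ->
  (\sum_(1 <= l < nb_stages.+1)
    P p (stage_event l [set z | (p + ea <= z /\ p * (1 + er) <= z)%R])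
   < (delta / 2)%:E)%E.
Proof.
move=> p01; have /andP[p0 p1] := p01; have [hQa _ hQr _] := htail.
have e0 := ea_gt0; have r0 := er_gt0; have r1 := er_lt1; have pe := pstar_er.
set A := [set z | _]; have mA : measurable A by apply: measurableI; exact: measurable_ge_ray.
have [none|[v [vg /andP[v1 v2] vmin]]] := @seq_extremum _ <=%R grid
  (fun z => (p + ea <= z) && (p * (1 + er) <= z)) (@le_total _ R) (@le_trans _ R).
  apply: le_lt_trans (hQa pstar _); last by right.
  apply: (@stage_sum_le p pstar A [set z | pstar + ea <= z]) => // l hl z zl [z1 z2].
  by have := none z (mem_grid hl zl); rewrite z1 z2.
have [l [hl [k vk]]] := gridP vg; have /andP[vge0 vle1] := grid_itv vg.
have /andP[ps0 ps1] := pstar01.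
have [vle|vgt] := leP v (pstar + ea).
- apply: le_lt_trans (hQa (v - ea) _); last first.
    have [vlt|] := ltP (v - ea) pstar; last by right => /=; lra.
    left; exists l => //=; split; first by apply/andP; split; lra.
    by exists k; rewrite vk.
  apply: (@stage_sum_le p (v - ea) A [set z | v - ea + ea <= z]) => //.
    by apply/andP; split; lra.
  move=> m hm z zm [z1 z2] /=; have zv : v <= z.
    by apply: vmin; [exact: mem_grid zm | rewrite z1 z2].
  by split; [lra | left; apply/andP; split; lra].
- have r2 : 0 < 1 + er by lra.
  have qp : p <= v / (1 + er) by rewrite ler_pdivlMr.
  have ql : pstar < v / (1 + er) by rewrite ltr_pdivlMr // mulrDr mulr1 pe.
  (* With [v <= 1] this keeps the new parameter below 1, as [Qr_plus] requires. *)
  have vq : v / (1 + er) < v by rewrite ltr_pdivrMr // ltr_pMr //; lra.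
  apply: le_lt_trans (hQr (v / (1 + er)) _); last first.
    exists l => //=; split; first by apply/andP; split; lra.
    by exists k; rewrite vk invfM mulrA.
  apply: (@stage_sum_le p (v / (1 + er)) A
    [set z | v / (1 + er) * (1 + er) <= z]) => //.
    by apply/andP; split; lra.
  move=> m hm z zm [z1 z2] /=; have zv : v <= z.
    by apply: vmin; [exact: mem_grid zm | rewrite z1 z2].
  rewrite divfK ?gt_eqF //; split=> //; left; apply/andP; split; lra.
Qed.

(** * The stopping stage and the final estimate *)

(** The last stage always stops, so the search succeeds; every sample point thus lies in a stage
    event at its own stopping stage. *)
Lemma stopping_stageP (t : T) :
  [/\ (1 <= stopping_stage t <= nb_stages)%N, D_ (stopping_stage t) t = 1%N &
      D_ (stopping_stage t).-1 t = 0%N].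
Proof.
rewrite /Defs.stopping_stage; set a := fun l => _; set i := find _ _.
have s0 := nb_stages_gt0.
have hs : has a (iota 1 nb_stages).
  apply/hasP; exists nb_stages; first by rewrite mem_iota add1n ltnS s0 leqnn.
  by rewrite /a /Defs.D_ (gtn_eqF s0) eqxx.
have iN : (i < nb_stages)%N by rewrite -[X in (_ < X)%N](size_iota 1) -has_find.
split=> //=.
- by have := nth_find 0%N hs; rewrite -/i nth_iota // add1n => /eqP.
(* Stopping at stage 1 uses [D_ 0 = 0]; otherwise minimality excludes the value 1 and leaves 0. *)
- have [->//|i0] := posnP i.
  have : a (nth 0%N (iota 1 nb_stages) i.-1) = false.
    by apply: before_find; rewrite -/i prednK.
  rewrite nth_iota; last by rewrite (leq_ltn_trans (leq_pred _)).
  rewrite add1n prednK // /a => /eqP.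
  by rewrite /Defs.D_; do !case: ifP.
Qed.

Lemma measurable_stopping_stage (l : nat) : measurable [set t | stopping_stage t = l].
Proof.
have mfind (s : seq nat) (k : nat) :
    measurable [set t | find (fun l => D_ l t == 1%N) s = k].
  elim: s k => [|j s IH] k /=.
    have [->|k0] := eqVneq k 0%N.
      by rewrite (_ : [set _ | _] = setT) //; apply/seteqP.
    rewrite (_ : [set _ | _] = set0) //; apply/seteqP; split=> // t /= h.
    by rewrite -h in k0.
  case: k => [|k].
    rewrite (_ : [set _ | _] = [set t | D_ j t = 1%N]); first exact: measurable_D.
    by apply/seteqP; split=> t /=; [case: ifP => // /eqP | move=> ->].
  rewrite (_ : [set _ | _] = ~` [set t | D_ j t = 1%N] `&`
    [set t | find (fun l => D_ l t == 1%N) s = k]).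
    by apply: measurableI => //; apply: measurableC; exact: measurable_D.
  apply/seteqP; split=> t /=.
    by case: ifP => // /eqP h [<-].
  by move=> [/eqP/negbTE -> ->].
case: l => [|l].
  by rewrite (_ : [set _ | _] = set0) //; apply/seteqP; split.
rewrite (_ : [set _ | _] = [set t | find (fun l => D_ l t == 1%N) (iota 1 nb_stages) = l]) //.
by apply/seteqP; split=> t /= => [[]|/eq_S].
Qed.

Lemma measurable_phat (A : set R) : measurable A -> measurable [set t | A (phat t)].
Proof.
move=> mA; rewrite (_ : [set t | _] = \bigcup_(l in `I_nb_stages.+1)
  ([set t | stopping_stage t = l] `&` [set t | A (phat_ l t)])).
  apply: fin_bigcup_measurable => // l _; apply: measurableI.
    exact: measurable_stopping_stage.
  exact: measurable_phat_preimage.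
apply/seteqP; split=> t /=.
- move=> At; have [/andP[_ h] _ _] := stopping_stageP t.
  by exists (stopping_stage t).
- by move=> [l _ [/= <-]].
Qed.

(** Outside [S] both criteria fail, and the sign of [phat - p] puts both failures on the same side.
    A union bound over the stages of each tail then costs less than [delta / 2] per tail. *)
Lemma coverage (p : R) : 0 < p < 1 ->
  ((1 - delta)%:E <
   P p [set t | (`|phat t - p| < ea \/ `|(phat t - p) / p| < er)%R])%E.
Proof.
move=> p01; have /andP[p0 p1] := p01.
set S := [set t | _].
have SE : S = [set t | (`]p - ea, p + ea[ `|` `]p - p * er, p + p * er[) (phat t)].
  apply/seteqP; split=> t; rewrite /S /= !in_itv /= -!ltr_distlC.
    move=> [h|h]; [left|right]; rewrite distrC //.
    by move: h; rewrite normrM normfV (gtr0_norm p0) ltr_pdivrMr // mulrC.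
  rewrite !(distrC p) => -[h|h]; [left|right] => //.
  by rewrite normrM normfV (gtr0_norm p0) ltr_pdivrMr // mulrC.
have mS : measurable S.
  by rewrite SE; apply: measurable_phat; exact: measurableU.
pose A := [set z : R | z <= p - ea /\ z <= p * (1 - er)].
pose B := [set z : R | p + ea <= z /\ p * (1 + er) <= z].
have mA : measurable A by apply: measurableI; exact: measurable_le_ray.
have mB : measurable B by apply: measurableI; exact: measurable_ge_ray.
(* Indices start at 0 here and stages at 1. *)
pose F i := stage_event i.+1 A; pose G i := stage_event i.+1 B.
have mF i : measurable (F i) by exact: measurable_stage_event.
have mG i : measurable (G i) by exact: measurable_stage_event.
pose UF := \big[setU/set0]_(i < nb_stages) F i.
pose UG := \big[setU/set0]_(i < nb_stages) G i.
have mUF : measurable UF by exact: bigsetU_measurable.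
have mUG : measurable UG by exact: bigsetU_measurable.
have SC : ~` S `<=` UF `|` UG.
  rewrite SE => t /= /not_orP; rewrite !in_itv /= => -[h1 h2].
  have [hl D1 D0] := stopping_stageP t; have /andP[l1 ls] := hl.
  have e0 := ea_gt0; have r0 := mulr_gt0 p0 er_gt0.
  have inF (C : set R) : C (phat t) -> (\bigcup_(i in `I_nb_stages) stage_event i.+1 C) t.
    move=> Ct; exists (stopping_stage t).-1; first by rewrite /mkset prednK.
    by rewrite prednK.
  have [h|h] := leP (phat t) p; [left|right]; rewrite /UF /UG -bigcup_mkord;
    apply: inF; rewrite /A /B /= ?mulrBr ?mulrDr ?mulr1;
    split; rewrite leNgt; apply/negP => hh.
  - by apply: h1; rewrite hh /=; lra.
  - by apply: h2; rewrite hh /=; lra.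
  - by apply: h1; rewrite hh andbT; lra.
  - by apply: h2; rewrite hh andbT; lra.
have sumE (H : nat -> \bar R) :
    (\sum_(i < nb_stages) H i.+1 = \sum_(1 <= l < nb_stages.+1) H l)%E.
  by rewrite big_add1 /= big_mkord.
have PF : (P p UF < (delta / 2)%:E)%E.
  apply: le_lt_trans (tail_sum_below p01); rewrite -sumE.
  exact: Boole_inequality.
have PG : (P p UG < (delta / 2)%:E)%E.
  apply: le_lt_trans (tail_sum_above p01); rewrite -sumE.
  exact: Boole_inequality.
have PC : (P p (~` S) < delta%:E)%E.
  apply: (@le_lt_trans _ _ (P p (UF `|` UG))).
    by apply: le_measure; rewrite ?inE //; [exact: measurableC | exact: measurableU].
  apply: le_lt_trans (measureU2 _ mUF mUG) _.
  by rewrite [delta]splitr EFinD; exact: lteD.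
move: PC; rewrite probability_setC // EFinB.
have : P p S \is a fin_num by exact: fin_num_measure.
case: (P p S) => // r _; rewrite -!EFinB !lte_fin => h; lra.
Qed.

End scheme_parameters.

Theorem theorem2 (R : realType) (ea er zeta delta rho : R)
    (d : measure_display) (T : measurableType d)
    (X : nat -> {mfun T >-> R}) (P : R -> probability T R)
    (hdelta : 0 < delta < 1) (hzeta : 0 < zeta) (hzd : zeta * delta < 1)
    (hrho : 0 < rho) (hea : 0 < ea < 3 / 8)
    (her : 6 * ea / (3 - 2 * ea) < er < 1)
    (hX : forall p : R, 0 < p < 1 -> iid_bernoulli (P p) X p) :
  (tail_conditions ea er zeta delta rho X P ->
   forall p : R, 0 < p < 1 ->
     ((1 - delta)%:E <
      P p [set t | (`|phat ea er zeta delta rho X t - p| < ea \/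
                    `|(phat ea er zeta delta rho X t - p) / p| < er)%R])%E)
  /\
  (zeta < 1 / (2 * ((tau ea er rho)%:R + 1)) ->
   tail_conditions ea er zeta delta rho X P).
Proof.
split; first by move=> htail p p01; exact: coverage.
exact: tail_conditions_small_zeta.
Qed.
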